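(* Let $\Lambda,\Gamma$ be rings, $C$ a $\Lambda$-$\Gamma$-bimodule, and $M$ a $\Gamma$-module with a fixed resolution $\cdots\to P_1\xrightarrow{d_1}P_0\to M\to0$ by finitely generated projective $\Gamma$-modules. Let $W$ be a $\Lambda$-module and $\lambda_W\colon W\to M^{\dagger}=\operatorname{Hom}_\Gamma(M,C)$ a homomorphism of $\Lambda$-modules. Let $S$ be a nonempty set and, for each $p\in S$, let $d_p$ be a function assigning to every $\Lambda$-module an element of $\{0,1,2,\dots\}\cup\{\infty\}$, such that $d_p$ satisfies $(\widetilde{d1})$ and (d3) for every $p\in S$. Write $t=t(\lambda_W)\in\{0,1,2,\dots\}\cup\{\infty\}$. Let $C'$ be a direct summand of a finite direct sum of copies of $C$ (as a $\Lambda$-module). Then: (1) $i\le T^{X_{i}(C)}(C')$ for every integer $i$, and $\widetilde{S}^{C}(C')=\infty$. (2) For $0\le i\le2$: if $d'$ is a function from $\Lambda$-modules to $\{0,1,2,\dots\}\cup\{\infty\}$ which satisfies $(\widetilde{d1})$ and $t+i-1\le d'(C'')$ for every direct summand $C''$ of a finite direct sum of copies of $C$, then $t+i-2\le d'(O^{i}(\lambda_{W}))$. (3) $Y^{C}(O^{i}(\lambda_{W}))\subseteq X_{t+i-1}(C)$ for $0\le i\le 2$. (4) $t+i-2\le T^{X_{t+i-1}(C)}(O^{i}(\lambda_{W}))\le\widetilde{S}^{C}(O^{i}(\lambda_{W}))$ for $0\le i\le2$. (5) For $0\le i\le 2$: $t+i-2=T^{X_{t+i-1}(C)}(O^{i}(\lambda_{W}))$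 if and only if $t+i-2=\widetilde{S}^{C}(O^{i}(\lambda_{W}))$.
   Context: Conventions: $\Lambda$-modules are left modules, $\Gamma$-modules are right modules, so $(-)^\dagger=\operatorname{Hom}_\Gamma(-,C)$ takes $\Gamma$-modules to $\Lambda$-modules. Infimum of the empty set is $\infty$, and $\infty+n=\infty$ for every integer $n$. Conditions on a function $d$ from $\Lambda$-modules to $\{0,1,\dots\}\cup\{\infty\}$, required for every short exact sequence $0\to K\to L\to N\to0$ of $\Lambda$-modules: $(\widetilde{d1})$ if $d(L)>d(K)$, then $d(K)\ge d(N)+1$; (d3) if $d(L)<d(N)$, then $d(K)\le d(L)$. Definition of $\mathrm{E}^i$ and $t$: $\mathrm{E}^1(\lambda_W)=\operatorname{Ker}\lambda_W$, $\mathrm{E}^2(\lambda_W)=\operatorname{Coker}\lambda_W$, $\mathrm{E}^i(\lambda_W)=\operatorname{Ext}^{i-2}_\Gamma(M,C)$ for $i\ge3$; and $t(\lambda_W)=\inf\{i\ge0\mid \mathrm{E}^{i+1}(\lambda_W)\ne0\}$. Definition of $O^i$: $O^0(\lambda_W)=\operatorname{Coker}(d_1^\dagger\colon P_0^\dagger\to P_1^\dagger)$, $O^1(\lambda_W)=\operatorname{Im}(d_1^\dagger\colon P_0^\dagger\to P_1^\dagger)$, $O^2(\lambda_W)=W$. For a $\Lambda$-module $N$, a subset $U\subseteq S$, and $i$ an integer or $\infty$: $X_i(N)=\{p\in S\mid i\le d_p(N)\}$; $Y^C(N)=\{p\in S\mid d_p(N)<d_p(C)\}$; $T^U(N)=\inf\{d_p(N)\mid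 p\in U\}$; $\widetilde{S}^C(N)$ is the supremum of the integers $i$ such that $d_p(N)\ge\inf\{i,d_p(C)\}$ for all $p\in S$. *)

(* Defs.v *)
From HB Require Import structures.
From mathcomp Require Import all_boot all_order all_algebra generic_quotient.
From mathcomp Require Import ring_quotient.
From mathcomp Require Import boolp classical_sets constructive_ereal.

Set Implicit Arguments.
Unset Strict Implicit.
Unset Printing Implicit Defensive.

Import Order.TTheory GRing.Theory Num.Theory.
Local Open Scope classical_set_scope.
Local Open Scope ring_scope.
Local Open Scope quotient_scope.

(* A right G-module is a left module over the converse ring: x . g is
   written g *: x. *)
Notation rmodType G := (lmodType G^c).

HB.mixin Record Lmodule_isBimodule (L G : pzRingType) C of GRing.Lmodule L C := {
  rscale : C -> G -> C;
  rscaleA : forall c g h, rscale (rscale c g) h = rscale c (g * h);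
  rscale1 : forall c, rscale c 1 = c;
  rscaleDl : forall c c' g, rscale (c + c') g = rscale c g + rscale c' g;
  rscaleDr : forall c g h, rscale c (g + h) = rscale c g + rscale c h;
  scale_rscale : forall (l : L) c g, rscale (l *: c) g = l *: rscale c g
}.

#[short(type="bimodType")]
HB.structure Definition Bimodule (L G : pzRingType) :=
  { C of Lmodule_isBimodule L G C & GRing.Lmodule L C }.

(* The underlying right G-module of C; an alias of the carrier is needed to
   hold this second module structure. *)
Definition right_mod (L G : pzRingType) (C : bimodType L G) : Type := C.

Section RightMod.
Variables (L G : pzRingType) (C : bimodType L G).

HB.instance Definition _ := GRing.Zmodule.on (right_mod C).

Definition right_scale (g : G^c) (c : right_mod C) : right_mod C :=
  rscale (c : C) (g : G).

Fact right_scaleA (a b : G^c) v :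
  right_scale a (right_scale b v) = right_scale (a * b) v.
Proof. exact: rscaleA. Qed.
Fact right_scale1 : left_id (1 : G^c) right_scale.
Proof. exact: rscale1. Qed.
Fact right_scaleDr : right_distributive right_scale +%R.
Proof. by move=> g c c'; exact: rscaleDl. Qed.
Fact right_scaleDl v : {morph right_scale^~ v : a b / a + b}.
Proof. by move=> a b; exact: rscaleDr. Qed.

HB.instance Definition _ := GRing.Zmodule_isLmodule.Build G^c (right_mod C)
  right_scaleA right_scale1 right_scaleDr right_scaleDl.

End RightMod.

(* Hom_G(M, C), with the left L-module structure induced by that of C. *)
Definition dagger (L G : pzRingType) (M : rmodType G) (C : bimodType L G) : Type :=
  {linear M -> right_mod C}.

Lemma linear_ext (R : pzRingType) (U V : lmodType R) (f g : {linear U -> V}) :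
  (forall x, f x = g x) -> f = g.
Proof.
case: f g => [f [[f1] [f2]]] [g [[g1] [g2]]] /= /funext fg; subst g.
by rewrite (Prop_irrelevance f1 g1) (Prop_irrelevance f2 g2).
Qed.

Section Dagger.
Variables (L G : pzRingType) (M : rmodType G) (C : bimodType L G).
Implicit Types f g h : dagger M C.

HB.instance Definition _ := gen_eqMixin (dagger M C).
HB.instance Definition _ := gen_choiceMixin (dagger M C).

Definition dagger_fun f : M -> C := fun x => (f : {linear M -> right_mod C}) x.

Definition dagger_zero : dagger M C := (\0 : M -> right_mod C).
Definition dagger_opp f : dagger M C :=
  \- (f : {linear M -> right_mod C}).
Definition dagger_add f g : dagger M C :=
  (f : {linear M -> right_mod C}) \+ (g : {linear M -> right_mod C}).

Definition dagger_scale_fun (l : L) f : M -> right_mod C :=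
  fun x => l *: dagger_fun f x.

Fact dagger_scale_linear l f : linear (dagger_scale_fun l f).
Proof.
move=> a x y; rewrite /dagger_scale_fun /dagger_fun linearP.
rewrite [LHS]scalerDr; congr (_ + _); symmetry; exact: scale_rscale.
Qed.

HB.instance Definition _ l f :=
  GRing.isLinear.Build G^c M (right_mod C) _ (dagger_scale_fun l f)
    (dagger_scale_linear l f).

Definition dagger_scale l f : dagger M C := dagger_scale_fun l f.

Fact dagger_addA : associative dagger_add.
Proof. by move=> f g h; apply: linear_ext => x /=; exact: addrA. Qed.
Fact dagger_addC : commutative dagger_add.
Proof. by move=> f g; apply: linear_ext => x /=; exact: addrC. Qed.
Fact dagger_add0 : left_id dagger_zero dagger_add.
Proof. by move=> f; apply: linear_ext => x /=; exact: add0r. Qed.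
Fact dagger_addN : left_inverse dagger_zero dagger_opp dagger_add.
Proof. by move=> f; apply: linear_ext => x /=; exact: addNr. Qed.

HB.instance Definition _ := GRing.isZmodule.Build (dagger M C)
  dagger_addA dagger_addC dagger_add0 dagger_addN.

Fact dagger_scaleA a b f : dagger_scale a (dagger_scale b f) = dagger_scale (a * b) f.
Proof. by apply: linear_ext => x; exact: (scalerA a b (dagger_fun f x)). Qed.
Fact dagger_scale1 : left_id 1 dagger_scale.
Proof. by move=> f; apply: linear_ext => x; exact: (scale1r (dagger_fun f x)). Qed.
Fact dagger_scaleDr : right_distributive dagger_scale +%R.
Proof. by move=> a f g; apply: linear_ext => x; exact: (scalerDr a (dagger_fun f x) (dagger_fun g x)). Qed.
Fact dagger_scaleDl f : {morph dagger_scale^~ f : a b / a + b}.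
Proof. by move=> a b; apply: linear_ext => x; exact: (scalerDl (dagger_fun f x) a b). Qed.

HB.instance Definition _ := GRing.Zmodule_isLmodule.Build L (dagger M C)
  dagger_scaleA dagger_scale1 dagger_scaleDr dagger_scaleDl.

End Dagger.

Section DaggerMap.
Variables (L G : pzRingType) (M N : rmodType G) (C : bimodType L G).
Variable f : {linear M -> N}.

Definition dagger_map (h : dagger N C) : dagger M C :=
  (h : {linear N -> right_mod C}) \o f.

Fact dagger_map_linear : linear dagger_map.
Proof. by move=> a g h; apply: linear_ext. Qed.

HB.instance Definition _ :=
  GRing.isLinear.Build L (dagger N C) (dagger M C) _ dagger_map dagger_map_linear.

End DaggerMap.

Section SubQuotient.
Variables (R : pzRingType) (V : lmodType R) (U : submodClosed V).

Record submodule := Submodule { submodule_val :> V; _ : submodule_val \in U }.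

HB.instance Definition _ := [isSub for submodule_val].
HB.instance Definition _ := [Choice of submodule by <:].
HB.instance Definition _ := [SubChoice_isSubLmodule of submodule by <:].

(* submodClosed does not provide closure under opposite, which the quotient
   construction requires. *)
Definition as_zmod : {pred V} := U.
HB.instance Definition _ :=
  GRing.isSubmodClosed.Build R V as_zmod (GRing.subsemimodClosedP U).

Definition quotient_module : Type := {ideal_quot as_zmod}.

HB.instance Definition _ := GRing.Zmodule.on quotient_module.

Definition quotient_scale (a : R) (x : quotient_module) : quotient_module :=
  \pi_({ideal_quot as_zmod}) (a *: repr (x : {ideal_quot as_zmod})).

Lemma quotient_scale_pi a (v : V) :
  quotient_scale a (\pi_({ideal_quot as_zmod}) v) = \pi_({ideal_quot as_zmod}) (a *: v).
Proof.
apply/eqP; rewrite /quotient_scale -Quotient.idealrBE -scalerBr rpredZ //.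
by rewrite Quotient.idealrBE reprK.
Qed.

Fact quotient_scaleA a b x :
  quotient_scale a (quotient_scale b x) = quotient_scale (a * b) x.
Proof.
by rewrite -[x in RHS](reprK (x : {ideal_quot as_zmod})) !quotient_scale_pi scalerA.
Qed.
Fact quotient_scale1 : left_id 1 quotient_scale.
Proof. by move=> x; rewrite /quotient_scale scale1r reprK. Qed.
Fact quotient_scaleDr : right_distributive quotient_scale +%R.
Proof.
move=> a x y; rewrite -[x](reprK (x : {ideal_quot as_zmod})) -[y](reprK (y : {ideal_quot as_zmod})).
rewrite !quotient_scale_pi.
transitivity (quotient_scale a (\pi_({ideal_quot as_zmod})
  (repr (x : {ideal_quot as_zmod}) + repr (y : {ideal_quot as_zmod})))).
  by congr quotient_scale; symmetry; exact: Quotient.pi_add.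
rewrite quotient_scale_pi scalerDr; exact: Quotient.pi_add.
Qed.
Fact quotient_scaleDl x : {morph quotient_scale^~ x : a b / a + b}.
Proof.
move=> a b; rewrite -[x](reprK (x : {ideal_quot as_zmod})) !quotient_scale_pi scalerDl.
exact: Quotient.pi_add.
Qed.

HB.instance Definition _ := GRing.Zmodule_isLmodule.Build R quotient_module
  quotient_scaleA quotient_scale1 quotient_scaleDr quotient_scaleDl.

End SubQuotient.

Section KernelImage.
Variables (R : pzRingType) (A B : lmodType R) (f : {linear A -> B}).

Definition ker_pred : {pred A} := fun x => f x == 0.
Definition im_pred : {pred B} := fun y => `[< exists x, f x = y >].

Fact ker_pred_closed : subsemimod_closed ker_pred.
Proof.
split=> [|a x]; last first.
  by rewrite !unfold_in => /eqP fx; rewrite linearZ /= fx scaler0.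
split; first by rewrite unfold_in linear0.
by move=> x y; rewrite !unfold_in linearD => /eqP-> /eqP->; rewrite addr0.
Qed.
HB.instance Definition _ :=
  GRing.isSubmodClosed.Build R A ker_pred ker_pred_closed.

Fact im_pred_closed : subsemimod_closed im_pred.
Proof.
split=> [|a _ /asboolP[x <-]]; last first.
  by apply/asboolP; exists (a *: x); rewrite linearZ.
split; first by apply/asboolP; exists 0; rewrite linear0.
move=> _ _ /asboolP[x <-] /asboolP[y <-].
by apply/asboolP; exists (x + y); rewrite linearD.
Qed.
HB.instance Definition _ :=
  GRing.isSubmodClosed.Build R B im_pred im_pred_closed.

Definition Ker : lmodType R := submodule ker_pred.
Definition Img : lmodType R := submodule im_pred.
Definition Coker : lmodType R := quotient_module im_pred.

End KernelImage.

Section Homology.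
Variables (R : pzRingType) (A B D : lmodType R).
Variables (f : {linear A -> B}) (g : {linear B -> D}).

Definition boundary_pred : {pred Ker g} :=
  fun x => (submodule_val x : B) \in im_pred f.

Fact boundary_pred_closed : subsemimod_closed boundary_pred.
Proof.
split=> [|a x]; last by rewrite !unfold_in => fx; exact: (@rpredZ _ _ (im_pred f)).
split; first exact: (@rpred0 _ (im_pred f)).
by move=> x y; rewrite !unfold_in; exact: (@rpredD _ (im_pred f)).
Qed.
HB.instance Definition _ :=
  GRing.isSubmodClosed.Build R (Ker g) boundary_pred boundary_pred_closed.

(* Ker g / Im f when g \o f = 0; in general Ker g / (Ker g :&: Im f). *)
Definition homology : lmodType R := quotient_module boundary_pred.

End Homology.

Definition surjective (A B : Type) (f : A -> B) := forall y, exists x, f x = y.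

Definition exact_at (R : pzRingType) (A B D : lmodType R)
    (f : {linear A -> B}) (g : {linear B -> D}) :=
  forall y, g y = 0 <-> exists x, f x = y.

Definition short_exact (R : pzRingType) (K L N : lmodType R)
    (f : {linear K -> L}) (g : {linear L -> N}) :=
  [/\ injective f, exact_at f g & surjective g].

Definition finitely_generated (R : pzRingType) (V : lmodType R) :=
  exists (n : nat) (e : 'I_n -> V),
    forall v, exists a : 'I_n -> R, v = \sum_i a i *: e i.

Definition projective (R : pzRingType) (V : lmodType R) :=
  forall (A B : lmodType R) (g : {linear A -> B}) (f : {linear V -> B}),
    surjective g -> exists h : {linear V -> A}, forall v, g (h v) = f v.

(* {ffun 'I_n -> C} is the direct sum of n copies of C, and the product
   module (C' * D) is the direct sum of C' and D. *)
Definition summand_of_sum (R : pzRingType) (C C' : lmodType R) :=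
  exists (n : nat) (D : lmodType R)
    (f : {linear (C' * D)%type -> {ffun 'I_n -> C}}), bijective f.

(* res_d n is the differential d_{n+1} : P_{n+1} -> P_n. *)
Record fgproj_resolution (R : pzRingType) (M : lmodType R) := FGProjResolution {
  res_P : nat -> lmodType R;
  res_d : forall n, {linear res_P n.+1 -> res_P n};
  res_aug : {linear res_P 0 -> M};
  res_fg : forall n, finitely_generated (res_P n);
  res_proj : forall n, projective (res_P n);
  res_aug_surj : surjective res_aug;
  res_exact0 : exact_at (res_d 0) res_aug;
  res_exactS : forall n, exact_at (res_d n.+1) (res_d n)
}.

Section Invariants.
Variables (L G : pzRingType) (C : bimodType L G) (M : rmodType G).
Variable P : fgproj_resolution M.

(* The map d_{n+1}^dagger : P_n^dagger -> P_{n+1}^dagger. *)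
Definition dagger_d (n : nat) :
    {linear dagger (res_P P n) C -> dagger (res_P P n.+1) C} :=
  @dagger_map _ _ _ _ C (res_d P n).

(* Ext^j_G(M, C), computed from the given resolution. *)
Definition Ext (j : nat) : lmodType L :=
  match j with
  | 0 => Ker (dagger_d 0)
  | j'.+1 => homology (dagger_d j') (dagger_d j'.+1)
  end.

Variables (W : lmodType L) (lambda : {linear W -> dagger M C}).

(* E^i, for i >= 1; the value at i = 0 is irrelevant. *)
Definition Emod (i : nat) : lmodType L :=
  match i with
  | 0 | 1 => Ker lambda
  | 2 => Coker lambda
  | j.+2 => Ext j
  end.

Definition nonzero (V : lmodType L) := exists x : V, x <> 0.

Definition t_inv : \bar int :=
  infimum +oo%E [set (i%:Z)%:E | i in [set i : nat | nonzero (Emod i.+1)]].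

End Invariants.

(* O^i(lambda), for 0 <= i <= 2; the values at i > 2 are irrelevant. *)
Definition Omod (L G : pzRingType) (C : bimodType L G) (M : rmodType G)
    (P : fgproj_resolution M) (W : lmodType L) (lambda : {linear W -> dagger M C})
    (i : nat) : lmodType L :=
  match i with
  | 0 => Coker (dagger_d C P 0)
  | 1 => Img (dagger_d C P 0)
  | _ => W
  end.

Section DimensionLike.
Variable L : pzRingType.
Implicit Types d : lmodType L -> \bar int.
Local Open Scope ereal_scope.

(* Z u {-oo, +oo} is \bar int, and {0, 1, ...} u {oo} is its subset of
   elements that are at least 0. *)
Definition nat_oo_valued d := forall N, 0 <= d N.

Definition cond_d1 d :=
  forall (K M N : lmodType L) (f : {linear K -> M}) (g : {linear M -> N}),
    short_exact f g -> d K < d M -> d N + 1%:E <= d K.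

Definition cond_d3 d :=
  forall (K M N : lmodType L) (f : {linear K -> M}) (g : {linear M -> N}),
    short_exact f g -> d M < d N -> d K <= d M.

Variables (S : Type) (d : S -> lmodType L -> \bar int).
Implicit Type N : lmodType L.

Definition Xset (i : \bar int) N : set S := [set p | i <= d p N].

Definition Yset (C : lmodType L) N : set S := [set p | d p N < d p C].

Definition Tinf (U : set S) N : \bar int :=
  infimum +oo [set d p N | p in U].

(* The set of admissible integers contains every i <= 0, so the default value
   -oo for the empty set plays no role. *)
Definition Ssup (C : lmodType L) N : \bar int :=
  supremum -oo
    [set i%:E | i in [set i : int | forall p, Order.min i%:E (d p C) <= d p N]].

End DimensionLike.

(* Main.v *)
(** For a function d satisfying (d1~), a short exact sequence 0 -> K -> V -> N -> 0
    with k + 1 <= d(V) and k <= d(N) has k + 1 <= d(K).  Since t is the first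
    index where E^(t+1) does not vanish, O^i starts an exact sequence
    0 -> O^i -> P_n^dagger -> P_(n+1)^dagger -> ..., with n = 2 - i, that is exact
    for t + i - 2 steps, so k <= d(O^i) as soon as k <= t + i - 2 and k <= d of
    every P_m^dagger.  Each P_m^dagger is a summand of a finite sum of copies of C,
    and (d1~) with (d3) give d(C) <= d(C') for every such summand C': a splitting
    C' + D yields two exact sequences, and (d1~) applied to both would force
    d(D) < d(C') < d(D) if d(C') were too small.  Taking k = d_p(C) gives (3);
    the rest is order theory in the integers with infinities, where the infimum
    of a nonempty set of nonnegative elements is attained. *)
Require Import Defs.
From HB Require Import structures.
From mathcomp Require Import all_boot all_order all_algebra.
From mathcomp Require Import boolp classical_sets constructive_ereal.
From mathcomp Require Import generic_quotient ring_quotient zify.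

Set Implicit Arguments.
Unset Strict Implicit.
Unset Printing Implicit Defensive.

Import Order.TTheory GRing.Theory Num.Theory.
Local Open Scope classical_set_scope.
Local Open Scope ring_scope.

(** * Factorisation of linear maps and quotient modules *)

Definition linear_pack (R : pzRingType) (U V : lmodType R) (f : U -> V)
    (f_lin : linear f) : {linear U -> V} :=
  HB.pack f (GRing.isLinear.Build R U V _ f f_lin).

(** A set-theoretic section [s] of [g] yields [h \o s], which is linear because [h] is constant on
    the fibres of [g]. *)
Lemma linear_factor (R : pzRingType) (A B D : lmodType R)
    (g : {linear A -> B}) (h : {linear A -> D}) :
  surjective g -> (forall a, g a = 0 -> h a = 0) ->
  exists k : {linear B -> D}, forall a, k (g a) = h a.
Proof.
move=> g_surj gh; have [s sK] := choice g_surj.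
have hs a : h (s (g a)) = h a.
  apply/eqP; rewrite -subr_eq0 -linearB; apply/eqP/gh.
  by rewrite linearB sK subrr.
have k_lin : linear (h \o s).
  by move=> r x y; rewrite /= -linearP -[RHS]hs linearP !sK.
by exists (linear_pack k_lin).
Qed.

Definition submodule_incl (R : pzRingType) (V : lmodType R) (U : submodClosed V) :
  {linear submodule U -> V} := (\val : submodule U -> V).

(** Records the projection by its surjectivity and kernel alone, so that later arguments avoid
    representatives. *)
Lemma quotient_pi (R : pzRingType) (V : lmodType R) (U : submodClosed V) :
  exists g : {linear V -> quotient_module U},
    surjective g /\ forall v, g v = 0 <-> v \in U.
Proof.
pose pi (v : V) : quotient_module U := (\pi_({ideal_quot as_zmod U}) v)%qT.
have pi_lin : linear pi.
  move=> a x y; rewrite /pi.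
  transitivity (quotient_scale a (pi x) + pi y : quotient_module U).
    by rewrite quotient_scale_pi; exact: Quotient.pi_add.
  by [].
exists (linear_pack pi_lin); split=> [y|v].
  by exists (repr (y : {ideal_quot as_zmod U})); exact: reprK.
split=> [v0|vU].
  rewrite -[v]subr0; change (v - 0 \in as_zmod U); rewrite Quotient.idealrBE.
  by apply/eqP; rewrite -/(pi v) -/(pi 0); rewrite -[pi v]/(linear_pack pi_lin v) v0 -[pi 0]/(linear_pack pi_lin 0) linear0.
rewrite -(linear0 (linear_pack pi_lin)); apply/eqP.
by rewrite -[_ == _]/(pi v == pi 0) -Quotient.idealrBE subr0.
Qed.

(** * Direct summands and duals of projective modules *)

(** The complement is [Ker b], through the decomposition [z = a (b z) + (z - a (b z))]. *)
Lemma retract_summand_of_sum (R : pzRingType) (C A : lmodType R) (n : nat)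
    (a : {linear A -> {ffun 'I_n -> C}}) (b : {linear {ffun 'I_n -> C} -> A}) :
  (forall x, b (a x) = x) -> summand_of_sum C A.
Proof.
move=> ab; exists n, (Ker b).
have f_lin : linear (fun u : A * Ker b => a u.1 + submodule_incl _ u.2).
  by move=> r u v /=; rewrite !linearP scalerDr addrACA.
exists (linear_pack f_lin).
have ker_b z : z - a (b z) \in ker_pred b.
  by rewrite unfold_in linearB ab subrr.
exists (fun z => (b z, Submodule (ker_b z))) => [[x [y y_ker]]|z] /=.
  have by0 : b y = 0 by apply/eqP.
  have bE : b (a x + y) = x by rewrite linearD ab by0 addr0.
  congr pair; first exact: bE.
  apply: val_inj; transitivity (a x + y - a (b (a x + y))); first by [].
  by rewrite bE addrC addKr.
by rewrite addrC subrK.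
Qed.

(** Projectivity splits the surjection from a free module given by the generators; the coordinates
    of the splitting are the [s i]. *)
Lemma fg_projective_dual_basis (R : pzRingType) (V : lmodType R) :
  finitely_generated V -> projective V ->
  exists (n : nat) (e : 'I_n -> V) (s : 'I_n -> {linear V -> R^o}),
    forall v, v = \sum_i (s i v : R) *: e i.
Proof.
move=> [n [e e_gen]] V_proj; exists n, e.
have pi_lin : linear (fun x : {ffun 'I_n -> R^o} => \sum_i (x i : R) *: e i).
  move=> r x y; rewrite scaler_sumr -big_split /=.
  by apply: eq_bigr => i _; rewrite !ffunE scalerDl scalerA.
have pi_surj : surjective (linear_pack pi_lin).
  move=> v; have [a ->] := e_gen v; exists [ffun i => a i].
  by apply: eq_bigr => i _; rewrite ffunE.
have [s sK] := V_proj _ _ (linear_pack pi_lin) idfun pi_surj.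
have s_lin i : linear (fun v => s v i : R^o).
  by move=> r x y; rewrite linearP !ffunE.
by exists (fun i => linear_pack (s_lin i)) => v; rewrite -[LHS]sK.
Qed.

(** Evaluation on a dual basis maps into a power of [C]; the functionals [s i] give a map back, and
    the dual basis identity makes it a retraction. *)
Lemma dagger_summand_of_sum (L G : pzRingType) (C : bimodType L G)
    (Q : rmodType G) :
  finitely_generated Q -> projective Q -> summand_of_sum C (dagger Q C).
Proof.
move=> Q_fg Q_proj; have [n [e [s sK]]] := fg_projective_dual_basis Q_fg Q_proj.
have a_lin : linear (fun h : dagger Q C => [ffun i : 'I_n => dagger_fun h (e i)]).
  by move=> l h k; apply/ffunP => i; rewrite !ffunE.
have comb_lin (c : {ffun 'I_n -> C}) :
    linear (fun q : Q => \sum_i (s i q : G^c) *: (c i : right_mod C)).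
  move=> r x y; rewrite scaler_sumr -big_split /=.
  by apply: eq_bigr => i _; rewrite linearP scalerDl scalerA.
pose b (c : {ffun 'I_n -> C}) : dagger Q C := linear_pack (comb_lin c).
have b_lin : linear b.
  move=> l c c'; apply: linear_ext => q.
  (* Written with [rscale], the right action visibly commutes with the left one. *)
  transitivity (l *: (\sum_i rscale (c i) (s i q : G))
    + \sum_i rscale (c' i) (s i q : G) : C); last by [].
  rewrite scaler_sumr -big_split /=; apply: eq_bigr => i _.
  rewrite !ffunE; transitivity (rscale (l *: c i + c' i) (s i q : G)); first by [].
  by rewrite rscaleDl scale_rscale.
apply: (@retract_summand_of_sum _ _ _ n (linear_pack a_lin) (linear_pack b_lin)).
move=> h; apply: linear_ext => q.
rewrite [in RHS](sK q) linear_sum /=.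
by apply: eq_bigr => i _; rewrite linearZ ffunE.
Qed.

(** * Exactness of the dual complex *)

(** Left exactness of Hom: a map on [res_P P 0] killed by [dagger_d C P 0] vanishes on the kernel of
    [res_aug P], hence factors through [M]. *)
Lemma dagger_aug_exact (L G : pzRingType) (C : bimodType L G) (M : rmodType G)
    (P : fgproj_resolution M) :
  exact_at (dagger_map (C := C) (res_aug P)) (dagger_d C P 0).
Proof.
move=> h; split=> [h0|[k <-]]; last first.
  apply: linear_ext => q /=.
  have -> : res_aug P (res_d P 0 q) = 0 by apply/res_exact0; exists q.
  exact: linear0.
have [q /res_exact0[q' <-]|k kE] :=
    @linear_factor _ _ _ _ _ (h : {linear _ -> right_mod C}) (@res_aug_surj _ _ P).
  by have := congr1 (fun f : dagger _ C => dagger_fun f q') h0.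
by exists (k : dagger M C); apply: linear_ext.
Qed.

Lemma dagger_map_inj (L G : pzRingType) (C : bimodType L G) (A B : rmodType G)
    (f : {linear A -> B}) : surjective f -> injective (dagger_map (C := C) f).
Proof.
move=> f_surj h k hk; apply: linear_ext => y; have [x <-] := f_surj y.
exact: (congr1 (fun f : dagger A C => dagger_fun f x) hk).
Qed.

Lemma dagger_dK (L G : pzRingType) (C : bimodType L G) (M : rmodType G)
    (P : fgproj_resolution M) n h : dagger_d C P n.+1 (dagger_d C P n h) = 0.
Proof.
apply: linear_ext => q /=.
have -> : res_d P n (res_d P n.+1 q) = 0 by apply/res_exactS; exists q.
exact: linear0.
Qed.

Lemma homology0_exact (R : pzRingType) (A B D : lmodType R)
    (f : {linear A -> B}) (g : {linear B -> D}) :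
  (forall x, g (f x) = 0) -> ~ nonzero (homology f g) -> exact_at f g.
Proof.
move=> gf H0 y; split=> [gy|[x <-]//].
have y_ker : y \in ker_pred g by rewrite unfold_in gy.
have [pi [_ piE]] := quotient_pi (boundary_pred f (g := g)).
have /piE : pi (Submodule y_ker) = 0.
  by apply: contrapT => pi_y; apply: H0; exists (pi (Submodule y_ker)).
by rewrite !unfold_in => /asboolP.
Qed.

Lemma coker0_surjective (R : pzRingType) (A B : lmodType R)
    (f : {linear A -> B}) : ~ nonzero (Coker f) -> surjective f.
Proof.
move=> H0 y; have [pi [_ piE]] := quotient_pi (im_pred f).
have /piE : pi y = 0 by apply: contrapT => pi_y; apply: H0; exists (pi y).
by rewrite unfold_in => /asboolP.
Qed.

Lemma ker0_injective (R : pzRingType) (A B : lmodType R)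
    (f : {linear A -> B}) : ~ nonzero (Ker f) -> injective f.
Proof.
move=> H0 x y fxy.
have xy_ker : x - y \in ker_pred f by rewrite unfold_in linearB fxy subrr.
apply/eqP; rewrite -subr_eq0; apply/eqP; apply: contrapT => xy0.
by apply: H0; exists (Submodule xy_ker) => /(congr1 val).
Qed.

(** Replaces [f] by an injective map with the same image, so that a chain can restart one step
    further along the complex. *)
Lemma incl_im_exact (R : pzRingType) (A B D : lmodType R)
    (f : {linear A -> B}) (g : {linear B -> D}) :
  exact_at f g -> exact_at (submodule_incl (im_pred f)) g.
Proof.
move=> fg y; rewrite fg; split=> [y_im|[[z z_im] /= <-]]; last exact/asboolP.
by have yI : y \in im_pred f by [apply/asboolP]; exists (Submodule yI).
Qed.

Lemma injective_short_exact (R : pzRingType) (K V : lmodType R)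
    (f : {linear K -> V}) : injective f ->
  exists g : {linear V -> Coker f}, short_exact f g.
Proof.
move=> f_inj; have [g [g_surj gE]] := quotient_pi (im_pred f).
by exists g; split=> // y; rewrite gE unfold_in; split=> [/asboolP//|?]; apply/asboolP.
Qed.

(** Exactness identifies the cokernel of [f] with [Img g], which embeds in the next module. *)
Lemma image_short_exact (R : pzRingType) (K V V' : lmodType R)
    (f : {linear K -> V}) (g : {linear V -> V'}) : injective f -> exact_at f g ->
  exists h : {linear V -> Img g}, short_exact f h.
Proof.
move=> f_inj fg.
have im_g v : g v \in im_pred g by apply/asboolP; exists v.
have h_lin : linear (fun v => Submodule (im_g v) : Img g).
  by move=> r x y; apply: val_inj; exact: linearP.
exists (linear_pack h_lin); split=> // [y|[z]].
  rewrite -fg; split=> [/(congr1 val)//|gy]; exact: val_inj.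
by move=> z_im; have /asboolP[x xz] := z_im; exists x; apply: val_inj.
Qed.

Local Open Scope ereal_scope.

(** * Infima and suprema among extended integers *)

Lemma ereal_int_ge0P (x : \bar int) :
  0 <= x -> x = +oo \/ exists n : nat, x = (n%:Z)%:E.
Proof.
case: x => [[n|n]| |] //; last by left.
by move=> _; right; exists n.
Qed.

(** Natural numbers suffice as tests: when [x] is infinite, a finite [y] fails the test at
    [y + 1]. *)
Lemma lee_int_nat (x y : \bar int) :
  0 <= y -> (forall n : nat, (n%:Z)%:E <= x -> (n%:Z)%:E <= y) -> x <= y.
Proof.
move=> y0 xy; case: (leP 0 x) => [|/ltW x0]; last exact: le_trans x0 y0.
case/ereal_int_ge0P=> [x_oo|[n xn]]; last by rewrite xn; apply: xy; rewrite xn.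
rewrite x_oo in xy *; case/ereal_int_ge0P: y0 => [->//|[n yn]].
by have := xy n.+1 (leey _); rewrite yn lee_fin; lia.
Qed.

(** Well-ordering of the naturals; a set [A] without natural numbers consists of [+oo] alone. *)
Lemma ereal_int_ge0_min (A : set (\bar int)) :
  A `<=` [set x | 0 <= x] -> A !=set0 -> exists2 m, A m & lbound A m.
Proof.
move=> A0 [x Ax].
case: (pselect (exists n : nat, A (n%:Z)%:E)) => [exA|nA]; last first.
  have A_oo y : A y -> y = +oo.
    move=> Ay; case: (ereal_int_ge0P (A0 _ Ay)) => // -[n yn].
    by case: nA; exists n; rewrite -yn.
  by exists x => // y /A_oo ->; rewrite leey.
have exb : exists n : nat, `[< A (n%:Z)%:E >].
  by case: exA => n An; exists n; apply/asboolP.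
case: (ex_minnP exb) => m /asboolP Am m_min.
exists (m%:Z)%:E => // y Ay.
case: (ereal_int_ge0P (A0 _ Ay)) => [->|[n yn]]; first by rewrite leey.
by rewrite yn lee_fin lez_nat; apply: m_min; apply/asboolP; rewrite -yn.
Qed.

(** The default [+oo] covers the empty set; otherwise the least element is the infimum. *)
Lemma infimum_ge0_spec {A : set (\bar int)} : A `<=` [set x | 0 <= x] ->
  lbound A (infimum +oo A) /\ (infimum +oo A = +oo \/ A (infimum +oo A)).
Proof.
move=> A0; rewrite /infimum; case: ifPn => [/eqP->|/set0P An0].
  by split; [move=> ? []|left].
have [m Am lm] := ereal_int_ge0_min A0 An0.
case: xgetP => [y _ [ly uy]|/(_ m) []]; last by split=> // z; apply.
have -> : y = m by apply/eqP; rewrite eq_le (ly _ Am) (uy _ lm).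
by split=> //; right.
Qed.

Lemma le_infimum_ge0 (A : set (\bar int)) (x : \bar int) :
  A `<=` [set x | 0 <= x] -> (x <= infimum +oo A) <-> lbound A x.
Proof.
move=> /infimum_ge0_spec[lb attained]; split=> [xA y Ay|lx].
  exact: le_trans xA (lb _ Ay).
by case: attained => [->|/lx//]; rewrite leey.
Qed.

(** Since [supremum] selects an element of [supremums], one has to be exhibited: the maximum of a
    set bounded above, and [+oo] for an unbounded one. *)
Lemma supremum_int_spec (A : set int) : A !=set0 ->
  supremums [set i%:E | i in A] (supremum -oo [set i%:E | i in A]).
Proof.
move=> A0; rewrite /supremum; case: ifPn => [/eqP|/set0P An0].
  by case: A0 => a Aa /seteqP[/(_ a%:E) []]; exists a.
suff [y sup_y] : supremums [set i%:E | i in A] !=set0.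
  by case: xgetP => // /(_ y).
case: (pselect (exists b : int, ubound A b)) => [[b Ab]|nb].
  have [a Aa] := A0.
  (* The least distance [m] to the bound [b] locates the maximum [b - m]. *)
  have exb : exists n : nat, `[< A (b - n%:Z)%R >].
    exists `|b - a|%N; apply/asboolP.
    by have := Ab _ Aa => ?; have -> : (b - `|b - a|%N%:Z)%R = a by lia.
  case: (ex_minnP exb) => m /asboolP Am m_min.
  exists (b - m%:Z)%R%:E; split=> [_ [c Ac <-]|z]; last by apply; exists (b - m%:Z)%R.
  have cb := Ab _ Ac.
  have := m_min `|b - c|%N; rewrite lee_fin => /(_ _)/wrap[].
    by apply/asboolP; have -> : (b - `|b - c|%N%:Z)%R = c by lia.
  lia.
exists +oo; split=> [y _|[z| |] // ub_z]; first by rewrite leey.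
  case: nb; exists z => c Ac.
  by rewrite -lee_fin; apply: ub_z; exists c.
by have [a Aa] := A0; have := ub_z a%:E; rewrite leNgt ltNyr; apply; exists a.
Qed.

(** * Consequences of the conditions (d1~) and (d3) *)

(** If [d K] were below [k + 1], condition (d1~) would give [d N + 1 <= d K], contrary to
    [k <= d N]. *)
Lemma cond_d1_step (L : pzRingType) (d : lmodType L -> \bar int)
    (K V N : lmodType L) (f : {linear K -> V}) (g : {linear V -> N}) (k : nat) :
  cond_d1 d -> short_exact f g ->
  (k.+1%:Z)%:E <= d V -> (k%:Z)%:E <= d N -> (k.+1%:Z)%:E <= d K.
Proof.
move=> d1 fg kV kN; rewrite leNgt; apply/negP => Kk.
have := d1 _ _ _ _ _ fg (lt_le_trans Kk kV); rewrite leNgt => /negP; apply.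
apply: lt_le_trans Kk _.
by have := leeD2r 1%:E kN; rewrite -EFinD -PoszD addn1.
Qed.

(** Condition (d1~) for 0 -> Z -> N -> N -> 0 turns [d Z < d N] into [d N + 1 <= d Z]. *)
Lemma cond_d1_le_trivial (L : pzRingType) (d : lmodType L -> \bar int)
    (Z N : lmodType L) :
  cond_d1 d -> (forall z : Z, z = 0%R) -> d N <= d Z.
Proof.
move=> d1 Z0; rewrite leNgt; apply/negP => ZN.
have ex : short_exact (\0%R : {linear Z -> N}) (idfun : {linear N -> N}).
  split=> [x y _|y|y]; first by rewrite (Z0 x) (Z0 y).
    by split=> [/= ->|[x <-]//]; exists 0%R.
  by exists y.
have := d1 _ _ _ _ _ ex ZN; rewrite leNgt => /negP; apply.
by apply: lt_le_trans ZN _; rewrite leeDl.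
Qed.

(** Induction along 0 -> C -> C^(n+1) -> C^n -> 0: a value below [d C] in the middle would also be
    below that of C^n, and (d3) forbids this. *)
Lemma cond_d3_power (L : pzRingType) (d : lmodType L -> \bar int)
    (C : lmodType L) (n : nat) :
  cond_d1 d -> cond_d3 d -> d C <= d {ffun 'I_n -> C}.
Proof.
move=> d1 d3; elim: n => [|n IHn].
  by apply: cond_d1_le_trivial => // z; apply/ffunP => -[].
have f_lin : linear (fun x : C => [ffun i : 'I_n.+1 => if i == ord0 then x else 0%R]).
  move=> r x y; apply/ffunP => i; rewrite !ffunE.
  by case: eqP => //; rewrite scaler0 addr0.
have g_lin : linear
    (fun c : {ffun 'I_n.+1 -> C} => [ffun i : 'I_n => c (lift ord0 i)]).
  by move=> r x y; apply/ffunP => i; rewrite !ffunE.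
have ex : short_exact (linear_pack f_lin) (linear_pack g_lin).
  split=> [x y /ffunP/(_ ord0)|c|c]; first by rewrite !ffunE eqxx.
    split=> [c0|[x <-]]; last by apply/ffunP => i; rewrite !ffunE.
    exists (c ord0); apply/ffunP => i; rewrite ffunE.
    case: (unliftP ord0 i) => [j ->|->]; last by rewrite eqxx.
    by have /ffunP/(_ j) := c0; rewrite !ffunE.
  exists [ffun i => if unlift ord0 i is Some j then c j else 0%R].
  by apply/ffunP => i; rewrite !ffunE liftK.
rewrite leNgt; apply/negP => lt_C.
have := d3 _ _ _ _ _ ex (lt_le_trans lt_C IHn).
by rewrite leNgt lt_C.
Qed.

Lemma summand_le (L : pzRingType) (d : lmodType L -> \bar int)
    (C C' : lmodType L) :
  nat_oo_valued d -> cond_d1 d -> cond_d3 d -> summand_of_sum C C' -> d C <= d C'.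
Proof.
move=> d0 d1 d3 [n [D [f [f' fK f'K]]]].
have f_surj : surjective f by move=> y; exists (f' y).
have f_inj := can_inj fK.
(* [k1] and [k2] are the two projections, transported along the bijection [f]. *)
have [//|k1 k1E] := linear_factor
    (h := (@fst C' D : {linear (C' * D)%type -> C'})) f_surj.
  by move=> a; rewrite -(linear0 f) => /f_inj ->.
have [//|k2 k2E] := linear_factor
    (h := (@snd C' D : {linear (C' * D)%type -> D})) f_surj.
  by move=> a; rewrite -(linear0 f) => /f_inj ->.
have i1_lin : linear (fun x : C' => f (x, 0%R)).
  by move=> r x y; rewrite -linearP; congr (f (_, _)); rewrite /= scaler0 addr0.
have i2_lin : linear (fun x : D => f (0%R, x)).
  by move=> r x y; rewrite -linearP; congr (f (_, _)); rewrite /= scaler0 addr0.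
have ex1 : short_exact (linear_pack i1_lin) k2.
  split=> [x y /f_inj[]//|y|y]; last by exists (f (0%R, y)); rewrite k2E.
  have [[x1 x2] <-] := f_surj y; rewrite k2E; split=> [/= ->|[x /f_inj[_ <-]]//].
  by exists x1.
have ex2 : short_exact (linear_pack i2_lin) k1.
  split=> [x y /f_inj[]//|y|y]; last by exists (f (y, 0%R)); rewrite k1E.
  have [[x1 x2] <-] := f_surj y; rewrite k1E; split=> [/= ->|[x /f_inj[<- _]]//].
  by exists x2.
rewrite leNgt; apply/negP => C'C.
have C'n := lt_le_trans C'C (cond_d3_power C n d1 d3).
have DC' := d1 _ _ _ _ _ ex1 C'n.
(* Lying below another value, [d C'] is finite, so [d D + 1 <= d C'] gives a strict inequality. *)
have lt_D : d D < d C'.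
  move: C'n DC' (d0 D) (d0 C'); case: (d C') => [c| |] //; last by rewrite ltNge leey.
  by case: (d D) => [e| |] // _; rewrite -EFinD !lee_fin lte_fin; lia.
have := d1 _ _ _ _ _ ex2 (lt_trans lt_D C'n); rewrite leNgt => /negP; apply.
by apply: lt_le_trans lt_D _; rewrite leeDl.
Qed.

(** * Propagation of bounds along the dual complex *)

(** Induction on [k]: for [k >= 2] the cokernel of [f] is the image of the next differential, and
    its inclusion starts a chain shorter by one. The guards on [k] demand only the exactness that is
    consumed. *)
Lemma le_dagger_chain (L G : pzRingType) (C : bimodType L G) (M : rmodType G)
    (P : fgproj_resolution M) (d : lmodType L -> \bar int) (k n : nat)
    (K : lmodType L) (f : {linear K -> dagger (res_P P n) C}) :
  nat_oo_valued d -> cond_d1 d ->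
  (forall m, (k%:Z)%:E <= d (dagger (res_P P m) C)) ->
  ((0 < k)%N -> injective f) ->
  ((1 < k)%N -> exact_at f (dagger_d C P n)) ->
  (forall j, (j.+2 < k)%N ->
    exact_at (dagger_d C P (n + j)) (dagger_d C P (n + j).+1)) ->
  (k%:Z)%:E <= d K.
Proof.
move=> d0 d1; elim: k n K f => [|[|k] IHk] n K f kP f_inj f_ex P_ex.
- exact: d0.
(* For [k = 1], nonnegativity already bounds the value on the cokernel. *)
- have [g fg] := injective_short_exact (f_inj isT).
  exact: cond_d1_step d1 fg (kP n) (d0 _).
have [g fg] := image_short_exact (f_inj isT) (f_ex isT).
apply: cond_d1_step d1 fg (kP n) _.
apply: (IHk _ _ (submodule_incl _)) => [m|_|k1|j jk].
- by apply: le_trans (kP m); rewrite lee_fin lez_nat.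
- exact: val_inj.
- by have /incl_im_exact := P_ex 0%N k1; rewrite addn0.
- by rewrite addSnnS; exact: P_ex.
Qed.

(** A nonzero [Emod P lambda j.+1] would place [j] in the set whose infimum is [t_inv]. *)
Lemma le_t_inv_vanish (L G : pzRingType) (C : bimodType L G) (M : rmodType G)
    (P : fgproj_resolution M) (W : lmodType L) (lambda : {linear W -> dagger M C})
    (k j : nat) :
  (k%:Z)%:E <= t_inv P lambda -> (j < k)%N -> ~ nonzero (Emod P lambda j.+1).
Proof.
rewrite /t_inv le_infimum_ge0 => [lb jk nz|_ [i _ <-]]; last by rewrite /= lee_fin.
by have := lb (j%:Z)%:E; rewrite lee_fin lez_nat leqNgt jk => /(_ _)/wrap[] //; exists j.
Qed.

(** Each [Omod] maps to the dual of [res_P P (2 - i)], and the vanishing of [Emod] in degrees 1 to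
    [k + 2 - i] supplies the hypotheses of [le_dagger_chain]. *)
Lemma le_Omod (L G : pzRingType) (C : bimodType L G) (M : rmodType G)
    (P : fgproj_resolution M) (W : lmodType L) (lambda : {linear W -> dagger M C})
    (d : lmodType L -> \bar int) (i k : nat) :
  (i <= 2)%N -> nat_oo_valued d -> cond_d1 d ->
  (forall m, (k%:Z)%:E <= d (dagger (res_P P m) C)) ->
  (k%:Z)%:E <= t_inv P lambda + (i%:Z - 2)%:E ->
  (k%:Z)%:E <= d (Omod P lambda i).
Proof.
move=> i2 d0 d1 kP kt.
have {}kt : ((k + (2 - i))%N%:Z)%:E <= t_inv P lambda.
  by case: (t_inv P lambda) kt => [r| |] //; rewrite -?EFinD ?lee_fin ?leey //; lia.
have vanish j := @le_t_inv_vanish _ _ _ _ _ _ _ _ j kt.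
(* [Emod] in degree [j + 3] is the homology at the dual of [res_P P j.+1], whence the shift by
   two. *)
have ex j : (j.+2 < k + (2 - i))%N -> exact_at (dagger_d C P j) (dagger_d C P j.+1).
  by move=> jk; apply: homology0_exact (vanish _ jk) => h; exact: dagger_dK.
case: i i2 kt vanish ex => [|[|[|//]]] _ kt vanish ex.
- rewrite /Omod; have [k0|k_gt0] := leqP k 0; first by case: k k0 {kP kt vanish ex}.
  have [g [g_surj gE]] := quotient_pi (im_pred (dagger_d C P 0)).
  have gE' y : g y = 0%R <-> exists x, dagger_d C P 0 x = y.
    by rewrite gE unfold_in; split=> [/asboolP//|?]; apply/asboolP.
  (* For [i = 0] the differential [dagger_d C P 1] descends to the cokernel; exactness at the dual
     of [res_P P 1] makes the induced map injective. *)
  have [y /gE'[x <-]|f fE] := linear_factor (h := dagger_d C P 1) g_surj.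
    exact: dagger_dK.
  apply: (@le_dagger_chain _ _ _ _ P d k 2 _ f) => // [_|k1|j jk].
  + move=> x y; have [x' <-] := g_surj x; have [y' <-] := g_surj y.
    rewrite !fE => fxy; apply/eqP; rewrite -subr_eq0 -linearB; apply/eqP/gE'/ex.
      lia.
    by rewrite linearB fxy subrr.
  + move=> y; have -> : (dagger_d C P 2 y = 0 <-> exists x, dagger_d C P 1 x = y)%R.
      by apply: ex; lia.
    split=> [[x <-]|[x <-]]; first by exists (g x).
    by have [x' <-] := g_surj x; exists x'.
  + by apply: ex; lia.
- apply: (@le_dagger_chain _ _ _ _ P d k 1 _ (submodule_incl _)) => // [_|k1|j jk].
  + exact: val_inj.
  + by apply/incl_im_exact/ex; lia.
  + by apply: ex; lia.
(* For [i = 2], [Ker lambda] vanishing makes this composite injective, and [Coker lambda] vanishing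
   gives exactness at the dual of [res_P P 0]. *)
have f_lin : linear (fun w => dagger_map (C := C) (res_aug P) (lambda w)).
  by move=> r x y; rewrite !linearP.
apply: (@le_dagger_chain _ _ _ _ P d k 0 _ (linear_pack f_lin)) => // [k0|k1|j jk].
- move=> x y /(dagger_map_inj (@res_aug_surj _ _ P)).
  by apply/ker0_injective/(vanish 0%N); lia.
- have /coker0_surjective lam_surj : ~ nonzero (Emod P lambda 2) by apply: vanish; lia.
  move=> y; rewrite dagger_aug_exact; split=> [[x <-]|[x <-]].
    by have [w <-] := lam_surj x; exists w.
  by exists (lambda x).
- by apply: ex; lia.
Qed.

(** * Universal properties of [Tinf] and [Ssup] *)

Lemma le_Tinf (L : pzRingType) (S : Type) (d : S -> lmodType L -> \bar int)
    (U : set S) (N : lmodType L) (x : \bar int) :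
  (forall p, nat_oo_valued (d p)) ->
  x <= Tinf d U N <-> forall p, U p -> x <= d p N.
Proof.
move=> d0; rewrite le_infimum_ge0; last by move=> _ [p _ <-]; exact: d0.
split=> [lb p Up|lb _ [p Up <-]]; last exact: lb.
by apply: lb; exists p.
Qed.

(** Nonnegativity of the [d p] makes 0 admissible, so the supremum is taken over a nonempty set. *)
Lemma Ssup_lub (L : pzRingType) (S : Type) (d : S -> lmodType L -> \bar int)
    (C N : lmodType L) (x : \bar int) :
  (forall p, nat_oo_valued (d p)) ->
  Ssup d C N <= x <->
  forall i : int, (forall p, Order.min i%:E (d p C) <= d p N) -> i%:E <= x.
Proof.
move=> d0.
have [|ub lub] := @supremum_int_spec
    [set i : int | forall p, Order.min i%:E (d p C) <= d p N].
  by exists 0%R => p; rewrite ge_min d0.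
split=> [le_x i iP|le_x]; last by apply: lub => _ [i iP <-]; exact: le_x.
by apply: le_trans le_x; apply: ub; exists i.
Qed.

Theorem proposition2p3 (L G : pzRingType) (C : bimodType L G)
    (M : rmodType G) (P : fgproj_resolution M)
    (W : lmodType L) (lambda : {linear W -> dagger M C})
    (S : Type) (S_nonempty : inhabited S) (d : S -> lmodType L -> \bar int)
    (d_val : forall p, nat_oo_valued (d p))
    (d_d1 : forall p, cond_d1 (d p))
    (d_d3 : forall p, cond_d3 (d p))
    (C' : lmodType L) (C'_summand : summand_of_sum C C') :
  let t := t_inv P lambda in
  let O := Omod P lambda in
  [/\ (forall i : int, i%:E <= Tinf d (Xset d i%:E C) C')
      /\ Ssup d C C' = +oo,
      forall i : nat, (i <= 2)%N ->
        forall d' : lmodType L -> \bar int,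
          nat_oo_valued d' -> cond_d1 d' ->
          (forall C'' : lmodType L, summand_of_sum C C'' ->
             t + (i%:Z - 1)%:E <= d' C'') ->
          t + (i%:Z - 2)%:E <= d' (O i),
      forall i : nat, (i <= 2)%N ->
        Yset d C (O i) `<=` Xset d (t + (i%:Z - 1)%:E) C,
      forall i : nat, (i <= 2)%N ->
        t + (i%:Z - 2)%:E <= Tinf d (Xset d (t + (i%:Z - 1)%:E) C) (O i)
        /\ Tinf d (Xset d (t + (i%:Z - 1)%:E) C) (O i) <= Ssup d C (O i)
    & forall i : nat, (i <= 2)%N ->
        (t + (i%:Z - 2)%:E = Tinf d (Xset d (t + (i%:Z - 1)%:E) C) (O i)
         <-> t + (i%:Z - 2)%:E = Ssup d C (O i))].

Proof.
move=> t O.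
have t0 : 0 <= t.
  by apply/le_infimum_ge0 => _ [i _ <-]; rewrite /= lee_fin.
have dC p C'' : summand_of_sum C C'' -> d p C <= d p C''.
  exact: summand_le.
have dagger_summand n : summand_of_sum C (dagger (res_P P n) C).
  by apply: dagger_summand_of_sum; [exact: res_fg|exact: res_proj].
have part2 i : (i <= 2)%N -> forall d', nat_oo_valued d' -> cond_d1 d' ->
    (forall n, t + (i%:Z - 1)%:E <= d' (dagger (res_P P n) C)) ->
    t + (i%:Z - 2)%:E <= d' (O i).
  (* As [t] may be infinite, the bound is tested on natural [k]; each such [k] is also at most
     [t + i - 1]. *)
  move=> i2 d' d'0 d'1 tP; apply: lee_int_nat => // k kt.
  apply: le_Omod => // n; apply: le_trans (le_trans kt _) (tP n).
  by apply: leeD2l; rewrite lee_fin; lia.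
have part3 i : (i <= 2)%N -> Yset d C (O i) `<=` Xset d (t + (i%:Z - 1)%:E) C.
  (* If [d p C < t + i - 1], then [d p C] is a finite [c] with [c <= t + i - 2], and [le_Omod] at
     [k = c] contradicts [d p (O i) < d p C]. *)
  move=> i2 p Yp; rewrite /Xset /= leNgt; apply/negP => Ct.
  case/ereal_int_ge0P: (d_val p C) => [C_oo|[c Cc]].
    by move: Ct; rewrite C_oo ltNge leey.
  move: Yp; rewrite /Yset /= ltNge => /negP; apply.
  rewrite Cc; apply: le_Omod => //.
    by move=> n; rewrite -Cc; exact: dC.
  rewrite -/t; move: Ct; rewrite Cc; case: (t) => [r| |] //; rewrite -?EFinD ?leey //.
  by rewrite lte_fin lee_fin; lia.
have part4a i : (i <= 2)%N ->
    t + (i%:Z - 2)%:E <= Tinf d (Xset d (t + (i%:Z - 1)%:E) C) (O i).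
  move=> i2; apply/le_Tinf => // p Xp; apply: part2 => // n.
  exact: le_trans Xp (dC _ _ _).
have part4b i : (i <= 2)%N ->
    Tinf d (Xset d (t + (i%:Z - 1)%:E) C) (O i) <= Ssup d C (O i).
  move=> i2; have /Ssup_lub ub := lexx (Ssup d C (O i)).
  (* Every natural [k] up to the infimum is admissible: on the [Xset] by the choice of [k], and
     outside it because [part3] excludes [d p (O i) < d p C]. *)
  apply: lee_int_nat => [|k kT]; apply: ub => // p; rewrite ge_min.
    by rewrite (d_val p _).
  have [Xp|nX] := pselect (Xset d (t + (i%:Z - 1)%:E) C p).
    by move/le_Tinf: kT => -> //.
  apply/orP; right; rewrite leNgt; apply/negP => Yp; exact/nX/(part3 _ i2).
split=> //.
- split=> [i|].
    by apply/le_Tinf => // p Xp; exact: le_trans Xp (dC _ _ _).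
  apply/eqP; rewrite eq_le leey /=.
  have /Ssup_lub ub := lexx (Ssup d C C').
  (* Every natural [k] is admissible for [C'], because [d p C <= d p C']. *)
  apply: lee_int_nat => [|k _]; apply: ub => // p; rewrite ge_min.
    by rewrite (d_val p _).
  by rewrite (dC p) // orbT.
- by move=> i i2 d' d'0 d'1 tC; apply: part2 => // n; exact: tC.
- by move=> i i2; split; [exact: part4a|exact: part4b].
(* By [part4a] and [part4b] the infimum lies between [t + i - 2] and the supremum. This settles the
   converse; the direct implication reduces to bounding every admissible integer by the infimum. *)
move=> i i2; split=> [tT|tS]; last first.
  by apply/eqP; rewrite eq_le part4a //= tS part4b.
apply/eqP; rewrite eq_le; apply/andP; split; first by rewrite tT part4b.
apply/Ssup_lub => // m mP.
have [|_ [T_oo|[p Xp pT]]] := @infimum_ge0_spec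
    [set d p (O i) | p in Xset d (t + (i%:Z - 1)%:E) C].
- by move=> _ [p _ <-]; exact: d_val.
- by rewrite tT /Tinf T_oo leey.
(* The infimum T is attained at p, where d_p(C) > T rules out admissible m > T. *)
have := mP p; rewrite ge_min pT -[infimum _ _]/(Tinf _ _ _) -tT => /orP[//|].
move/(le_trans Xp); case: (t) t0 => [r| |] // _; rewrite -?EFinD ?leey //.
by rewrite lee_fin; lia.
Qed.
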